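(* Let $c\ge 3$ and $\alpha\ge 2$ be integers such that $(c-1)\alpha$ is even. Then there is an $r$-regular $c$-partite tournament, with $r=(c-1)\alpha/2$ and all partite sets of cardinality $\alpha$, that contains an arc belonging to no triangle.
   Context: A $c$-partite tournament is an orientation of a complete $c$-partite graph (finite, with $c$ nonempty partite sets): between any two vertices in different partite sets there is exactly one arc, and there are no arcs within a partite set. A digraph is $r$-regular if $d^+(v)=d^-(v)=r$ for every vertex $v$; for an $r$-regular $c$-partite tournament with partite sets of cardinality $\alpha$ necessarily $r=(c-1)\alpha/2$. A triangle is a directed cycle of length $3$. *)

(* Defs.v *)
From mathcomp Require Import all_boot.

Set Implicit Arguments.
Unset Strict Implicit.
Unset Printing Implicit Defensive.

(* A digraph on the finite vertex type T is its arc relation e : rel T, with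
   e x y meaning that there is an arc from x to y. *)
Section Digraph.
Variables (T : finType) (e : rel T).

Definition out_degree (x : T) : nat := #|[set y | e x y]|.
Definition in_degree (x : T) : nat := #|[set y | e y x]|.

Definition regular_digraph (r : nat) : Prop :=
  forall x, out_degree x = r /\ in_degree x = r.

(* The blocks of a partition are nonempty. The addb in the last clause says
   that exactly one of the two arcs is present. *)
Definition multipartite_tournament (c : nat) (P : {set {set T}}) : Prop :=
  [/\ partition P [set: T],
      #|P| = c,
      forall x y, pblock P x = pblock P y -> ~~ e x y
    & forall x y, pblock P x != pblock P y -> e x y (+) e y x].

(* A directed cycle is the cyclic sequence of its (distinct) vertices; its arcs
   go from each vertex to the next one, cyclically. *)
Definition triangle (s : seq T) : bool := ucycleb e s && (size s == 3).

Definition arc_of_cycle (s : seq T) (u v : T) : bool :=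
  (u \in s) && (next s u == v).

Definition in_triangle (u v : T) : Prop :=
  exists2 s : seq T, triangle s & arc_of_cycle s u v.

End Digraph.

(* Main.v *)
Require Import Defs.
From mathcomp Require Import all_boot.
From mathcomp Require Import all_algebra zify.

Set Implicit Arguments.
Unset Strict Implicit.
Unset Printing Implicit Defensive.

(** Arrange the vertices as pairs (i, x), where i names the partite set and x
    lies in an abelian group G of order alpha.  Choose a tournament t on the
    partite sets, and for each arc i -> j of t a set S of s elements of G; let
    (i, x) dominate (j, y) when y - x lies in S, and be dominated by it
    otherwise.  Every vertex then has s out-neighbours in each part that t puts
    after its own and alpha - s in each part before it, and the other way round
    for in-neighbours ([out_degree_blowup], [in_degree_blowup]).  So the result
    is regular as soon as either alpha = 2 s or t is itself regular
    ([blowup_regular]).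

    For the arc, take an arc p -> q of t such that every other part dominated by
    p is dominated by q.  Between p and q, and only there, use a set S1 that
    avoids 0; between all other parts use one fixed set S0.  As 0 is not in S1,
    the arc between (p, 0) and (q, 0) runs against t, from (q, 0) to (p, 0).  A
    triangle through it would need a vertex w = (j, y) with
    (p, 0) -> w -> (q, 0).  If p and q relate to j in the same way, then
    (p, 0) and (q, 0) relate to w in the same way, and no such w exists.  The
    only other possibility is q -> j -> p in t, where w would need both y and
    - y to lie outside S0; this is impossible if S0 and - S0 cover G
    ([blowup_no_path]).

    In the cyclic group of order alpha, S0 is the first half and S1 the last
    half, rounded up.  If alpha is even, the halves are exact and t may be the
    transitive tournament, in which no j has q -> j -> p for the first two
    parts p and q.  If alpha is odd, then S0 and - S0 cover G; moreover c is
    odd, and t is the rotational tournament on the integers modulo c. *)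

(** * Translates in a finite abelian group *)

Section Translates.
Local Open Scope ring_scope.
Import GRing.Theory.
Variable G : finZmodType.

Lemma card_subr_preim (S : {set G}) x : #|[set y | y - x \in S]| = #|S|.
Proof.
have bij : {on mem S, bijective (fun y => y - x)}.
  by apply: onW_bij; exists (fun y => y + x) => y; rewrite ?addrK ?subrK.
by rewrite -(on_card_preimset bij); apply: eq_card => y; rewrite !inE.
Qed.

Lemma card_subl_preim (S : {set G}) x : #|[set y | x - y \in S]| = #|S|.
Proof.
have bij : {on mem S, bijective (fun y => x - y)}.
  by apply: onW_bij; exists (fun y => x - y) => y; rewrite subKr.
by rewrite -(on_card_preimset bij); apply: eq_card => y; rewrite !inE.
Qed.

End Translates.

(** * Partite sets as fibres *)

Section Fibres.
Variables I G : finType.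

Definition fibres : {set {set I * G}} := preim_partition fst [set: I * G].

Lemma fibres_partition : partition fibres [set: I * G].
Proof. exact: preim_partitionP. Qed.

Lemma pblock_fibres (u v : I * G) :
  (pblock fibres u == pblock fibres v) = (u.1 == v.1).
Proof.
have [/eqP cov triv _] := and3P fibres_partition.
rewrite eq_pblock //; last by rewrite cov inE.
by rewrite pblock_equivalence_partition ?inE // => x y z _ _ _; split=> // /eqP->.
Qed.

Lemma fibresE (x0 : G) :
  fibres = [set [set z : I * G | z.1 == i] | i in [set: I]].
Proof.
apply/setP=> A; apply/imsetP/imsetP=> [[u _ ->]|[i _ ->]].
  by exists u.1 => //; apply/setP=> z; rewrite !inE eq_sym.
by exists (i, x0) => //; apply/setP=> z; rewrite !inE eq_sym.
Qed.

Lemma card_fibres (x0 : G) : #|fibres| = #|I|.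
Proof.
rewrite (fibresE x0) card_imset ?cardsT // => i j /setP/(_ (i, x0)).
by rewrite !inE /= eqxx => /esym/eqP.
Qed.

Lemma card_fibre (x0 : G) (A : {set I * G}) : A \in fibres -> #|A| = #|G|.
Proof.
rewrite (fibresE x0) => /imsetP[i _ ->].
rewrite -cardsT -(card_imset setT (f := pair i)); last by move=> x y [].
apply: eq_card => -[j y]; rewrite !inE /=.
by apply/eqP/imsetP=> [->|[z _ [-> _]]]; first exists y.
Qed.

Lemma card_by_fibre (Q : pred (I * G)) :
  #|[set z | Q z]| = \sum_i #|[set y | Q (i, y)]|.
Proof.
rewrite -sum1_card (eq_bigl Q) => [|z]; last by rewrite inE.
rewrite (eq_bigl (fun z => true && Q (z.1, z.2))) => [|[i x]] //.
rewrite -(pair_big_dep xpredT (fun i y => Q (i, y)) (fun _ _ => 1)) /=.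
by apply: eq_bigr => i _; rewrite -sum1_card; apply: eq_bigl => y; rewrite inE.
Qed.

End Fibres.

(** * Blowing up a tournament *)

Definition tournament (I : finType) (t : rel I) : Prop :=
  irreflexive t /\ forall i j, i != j -> t i j (+) t j i.

Lemma tournament_asym (I : finType) (t : rel I) i j :
  tournament t -> t i j -> t j i = false.
Proof.
move=> [irr tot] tij; have ij : i != j.
  by apply: contraTneq tij => ->; rewrite irr.
by move: (tot i j ij); rewrite tij; case: (t j i).
Qed.

Lemma tournament_degrees (I : finType) (t : rel I) i :
  tournament t -> out_degree t i + in_degree t i = #|I| - 1.
Proof.
move=> tt; have [irr tot] := tt.
have disj : [set j | t i j] :&: [set j | t j i] = set0.
  by apply/setP=> j; rewrite !inE; apply/negP=> /andP[/(tournament_asym tt)->].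
rewrite /out_degree /in_degree -cardsUI disj cards0 addn0 subn1 -(cardC1 i).
apply: eq_card => j; rewrite !inE; case: eqVneq => [->|ji].
  by rewrite irr.
by have := tot j i ji; case: (t j i); case: (t i j).
Qed.

Section Blowup.
Import GRing.Theory.
Variables (I : finType) (G : finZmodType) (t : rel I) (p q : I).
Variables S0 S1 : {set G}.

Definition connection (i j : I) : {set G} :=
  if (i == p) && (j == q) then S1 else S0.

(** The arcs between two parts are decided by the arc of [t] between these
    parts, read from its tail to its head; this is why the second branch
    exchanges the two vertices. *)
Definition blowup : rel (I * G) := fun u v =>
  if t u.1 v.1 then (v.2 - u.2)%R \in connection u.1 v.1
  else t v.1 u.1 && ((u.2 - v.2)%R \notin connection v.1 u.1).

Hypothesis tt : tournament t.

Lemma blowup_multipartite : multipartite_tournament blowup #|I| (fibres I G).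
Proof.
have [irr tot] := tt; split.
- exact: fibres_partition.
- exact: card_fibres 0%R.
- by move=> u v /eqP; rewrite pblock_fibres /blowup => /eqP->; rewrite irr.
move=> u v; rewrite pblock_fibres => /tot; rewrite /blowup.
by case: (t u.1 v.1); case: (t v.1 u.1) => //= _; case: (_ \in _).
Qed.

Hypothesis S01 : #|S1| = #|S0|.

Lemma card_connection i j : #|connection i j| = #|S0|.
Proof. by rewrite /connection; case: ifP. Qed.

(** Only the cardinality of a connection set enters the degrees, since each
    vertex sees a translate of it, of its opposite or of a complement of these.
    So [S1] can replace [S0] between one pair of parts at no cost. *)
Lemma out_degree_blowup u : out_degree blowup u =
  out_degree t u.1 * #|S0| + in_degree t u.1 * (#|G| - #|S0|).
Proof.
case: u => i x /=; rewrite {1}/out_degree card_by_fibre /=.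
rewrite /out_degree /in_degree -!sum_nat_const.
rewrite [X in _ = addn X _]big_mkcond [X in _ = addn _ X]big_mkcond.
rewrite -big_split; apply: eq_bigr => j _ /=.
rewrite !inE /blowup /=; case: ifPn => [tij|_].
  by rewrite (tournament_asym tt tij) card_subr_preim card_connection addn0.
case: (t j i) => /=; last first.
  by rewrite -[RHS](cards0 G); apply: eq_card => y; rewrite !inE.
rewrite add0n -(card_connection j i) -[connection j i]setCK -cardsCs.
by rewrite -[RHS](card_subl_preim _ x); apply: eq_card => y; rewrite !inE ?negbK.
Qed.

Lemma in_degree_blowup u : in_degree blowup u =
  in_degree t u.1 * #|S0| + out_degree t u.1 * (#|G| - #|S0|).
Proof.
case: u => i x /=; rewrite {1}/in_degree card_by_fibre /=.
rewrite /out_degree /in_degree -!sum_nat_const.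
rewrite [X in _ = addn X _]big_mkcond [X in _ = addn _ X]big_mkcond.
rewrite -big_split; apply: eq_bigr => j _ /=.
rewrite !inE /blowup /=; case: ifPn => [tji|_].
  by rewrite (tournament_asym tt tji) card_subl_preim card_connection addn0.
case: (t i j) => /=; last first.
  by rewrite -[RHS](cards0 G); apply: eq_card => y; rewrite !inE.
rewrite add0n -(card_connection i j) -[connection i j]setCK -cardsCs.
by rewrite -[RHS](card_subr_preim _ x); apply: eq_card => y; rewrite !inE ?negbK.
Qed.

(** The out-degree minus the in-degree of a vertex is the product of the same
    difference in [t] with [#|S0| - (#|G| - #|S0|)]; the two hypotheses say that
    one or the other factor vanishes. *)
Lemma blowup_regular :
  (forall i, out_degree t i = in_degree t i) \/ #|G| = #|S0|.*2 ->
  regular_digraph blowup ((#|I| - 1) * #|G|)./2.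
Proof.
move=> bal u; rewrite out_degree_blowup in_degree_blowup.
rewrite -(tournament_degrees u.1 tt).
have := max_card (mem S0); case: bal => [->|->] le_s; last by split; nia.
have -> : (in_degree t u.1 + in_degree t u.1) * #|G| = (in_degree t u.1 * #|G|).*2.
  by rewrite addnn doubleMl.
by rewrite doubleK; split; rewrite -mulnDr ?subnKC.
Qed.

Hypothesis tpq : t p q.
Hypothesis S1_0 : 0%R \notin S1.

Lemma blowup_arc : blowup (q, 0%R) (p, 0%R).
Proof.
by rewrite /blowup /= (tournament_asym tt tpq) tpq /connection !eqxx subrr.
Qed.

Hypothesis dom : forall j, t p j -> j != q -> t q j.
Hypothesis cov : (forall j, ~~ (t q j && t j p)) \/
                 (forall y, (y \in S0) || ((- y)%R \in S0)).

(** Suppose that [(p, 0) -> (j, y) -> (q, 0)].  If [t p j], then [t q j] by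
    [dom], and both vertices compare with [(j, y)] through the same condition
    [y \in S0].  If [t j p] and [t j q], both do so through [- y \in S0].  There
    remains [t j p] with [t q j], where the two arcs say that neither [- y] nor
    [y] is in [S0]; this is what [cov] forbids. *)
Lemma blowup_no_path w : blowup (p, 0%R) w -> ~~ blowup w (q, 0%R).
Proof.
have [irr tot] := tt.
have pq : (p == q) = false by apply: contraTF tpq => /eqP->; rewrite irr.
case: w => j y; rewrite /blowup /connection /= !subr0 !sub0r.
have [->|jq] := eqVneq j q; first by rewrite irr.
have [->|jp] := eqVneq j p; first by rewrite irr.
rewrite ![q == p]eq_sym pq !andbF /=; case: ifP => [tpj yS|tpj /andP[tjp yS]].
  have tqj := dom tpj jq.
  by rewrite (tournament_asym tt tqj) tqj yS.
case: ifP => [_ //|_]; case: cov => [/(_ j)|/(_ y)].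
  by rewrite tjp andbT => /negbTE->.
by rewrite (negbTE yS) orbF => ->; rewrite andbF.
Qed.

End Blowup.

Lemma in_triangle_path (T : finType) (e : rel T) (u v : T) :
  in_triangle e u v -> exists2 w, e v w & e w u.
Proof.
case=> s /andP[+ /eqP size_s] /andP[+ /eqP].
case: s size_s => [|x [|y [|z [|//]]]] //= _ /andP[/=].
rewrite !inE !andbT => /and3P[exy eyz ezx].
rewrite negb_or => /andP[/andP[xy xz] yz] /or3P[]/eqP-> <- {u v}.
- by rewrite eqxx; exists z.
- by rewrite eq_sym (negbTE xy) eqxx; exists x.
by rewrite eq_sym (negbTE xz) eq_sym (negbTE yz) eqxx; exists y.
Qed.

(** * Tournaments with a suitable arc *)

Lemma ltn_tournament n : tournament (fun i j : 'I_n => i < j).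
Proof. by split=> [i|i j]; rewrite ?ltnn // -val_eqE /=; lia. Qed.

Section Rotational.
Variable k : nat.
Local Notation I := 'I_k.*2.+1.

Definition rotational : rel I := fun i j => 0 < (j - i)%R <= k.

(** Of a nonzero residue [d] and its opposite [k.*2.+1 - d], exactly one is at
    most [k]. *)
Lemma rotational_tournament : tournament rotational.
Proof.
split=> [i|i j ij]; first by rewrite /rotational GRing.subrr.
have : (j - i)%R != 0%R by rewrite GRing.subr_eq0 eq_sym.
rewrite /rotational -[(i - j)%R]GRing.opprB.
move: (j - i)%R => d; rewrite -val_eqE /= => d0.
rewrite modn_small; have := ltn_ord d; lia.
Qed.

(** Out- and in-neighbourhoods are a translate of one set of differences and a
    translate of its opposite. *)
Lemma rotational_regular i : out_degree rotational i = in_degree rotational i.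
Proof.
pose D := [set d : I | 0 < d <= k].
have out : out_degree rotational i = #|D|.
  by rewrite -(card_subr_preim D i); apply: eq_card => j; rewrite !inE.
by rewrite out -(card_subl_preim D i); apply: eq_card => j; rewrite !inE.
Qed.

End Rotational.

(** * Halves of a cyclic group *)

Lemma card_ord_ltn n m : m <= n -> #|[set y : 'I_n | y < m]| = m.
Proof.
move=> le_mn; rewrite -sum1_card (eq_bigl (fun y : 'I_n => y < m)) => [|y].
  by rewrite (big_ord_narrow le_mn) sum1_card card_ord.
by rewrite inE.
Qed.

Section Halves.
Variable n : nat.
Local Notation G := 'I_n.+1.

Definition lower_half : {set G} := [set y : G | y < uphalf n.+1].
Definition upper_half : {set G} := ~: [set y : G | y < n.+1./2].

Lemma card_lower_half : #|lower_half| = uphalf n.+1.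
Proof. by rewrite card_ord_ltn //; lia. Qed.

Lemma card_upper_half : #|upper_half| = uphalf n.+1.
Proof. rewrite cardsCs setCK card_ord card_ord_ltn; lia. Qed.

(** For a nonzero [y], the representatives of [y] and [- y] add up to [n.+1], so
    the smaller one is at most half of it.  For even [n.+1] the residue [n.+1./2]
    is its own opposite and lies outside the lower half. *)
Lemma lower_half_cover (y : G) :
  odd n.+1 -> (y \in lower_half) || ((- y)%R \in lower_half).
Proof.
move=> odd_n; rewrite !inE /=; have := ltn_ord y.
by case: (val y) => [|m] lt_m; [|rewrite modn_small]; lia.
Qed.

End Halves.

Theorem proposition4p3 (c alpha : nat) (hc : 3 <= c) (halpha : 2 <= alpha)
    (heven : ~~ odd ((c - 1) * alpha)) :
  exists (T : finType) (e : rel T) (P : {set {set T}}),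
    [/\ multipartite_tournament e c P,
        forall A : {set T}, A \in P -> #|A| = alpha,
        regular_digraph e ((c - 1) * alpha)./2
      & exists u v : T, e u v /\ ~ in_triangle e u v].
Proof.
case: alpha halpha heven => // n n_gt0 heven.
pose S0 := lower_half n; pose S1 := upper_half n.
have S01 : #|S1| = #|S0| by rewrite card_lower_half card_upper_half.
have S1_0 : 0%R \notin S1 by rewrite !inE /=; lia.
suff [t [p [q [tt tpq dom bal cov]]]] : exists (t : rel 'I_c) (p q : 'I_c),
    [/\ tournament t, t p q, forall j, t p j -> j != q -> t q j,
        (forall i, out_degree t i = in_degree t i) \/ #|'I_n.+1| = #|S0|.*2
      & (forall j, ~~ (t q j && t j p)) \/
        (forall y, (y \in S0) || ((- y)%R \in S0))].
  exists ('I_c * 'I_n.+1)%type, (blowup t p q S0 S1), (fibres 'I_c 'I_n.+1).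
  have mt := blowup_multipartite p q S0 S1 tt.
  have reg := blowup_regular p q tt S01 bal.
  rewrite !card_ord in mt reg; split=> //.
    by move=> A /(card_fibre 0%R); rewrite card_ord.
  exists (q, 0%R), (p, 0%R); split; first exact: blowup_arc.
  by move=> /in_triangle_path[w /(blowup_no_path tt tpq dom cov)/negP].
have [even_alpha|odd_alpha] := boolP (~~ odd n.+1).
  have c0 : 0 < c by lia.
  have c1 : 1 < c by lia.
  (* With p = 0 and q = 1, no part comes before p, so q -> j -> p is impossible. *)
  exists (fun i j => i < j), (Ordinal c0), (Ordinal c1); split=> //.
  - exact: ltn_tournament.
  - by move=> j; rewrite -val_eqE /=; lia.
  - by right; rewrite card_ord card_lower_half; lia.
  by left=> j; rewrite ltn0 andbF.
have [k cE] : exists k, c = k.*2.+1 by exists c./2; move: heven; rewrite oddM; lia.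
subst c; have k0 : 0 < k by lia.
have c1 : 1 < k.*2.+1 by lia.
(* Again p = 0 and q = 1: the other parts dominated by 0 are 2, ..., k, and 1
   dominates 2, ..., k + 1. *)
exists (@rotational k), ord0, (Ordinal c1).
have rot0 j : rotational (ord0 : 'I_k.*2.+1) j = (0 < j <= k).
  by rewrite /rotational GRing.subr0.
split.
- exact: rotational_tournament.
- by rewrite rot0.
- move=> j; rewrite rot0 -val_eqE /rotational /= => jk j1.
  rewrite modnDmr (_ : j + _ = j.-1 + k.*2.+1); last by lia.
  by rewrite modnDr modn_small; lia.
- by left; apply: rotational_regular.
by right=> y; apply: lower_half_cover; move: odd_alpha; rewrite negbK.
Qed.
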